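(* Let $X$ be a random variable with values in $\mathbb{R}^d$, with compact support denoted $\Omega_0$ and such that $\mathbb{E}[|X|]<\infty$. Let $(\hat\alpha,\hat b)$ be the strategy and control obtained by Algorithm 1 with margin errors $\eta_1,\eta_2>0$, and assume that $\hat\alpha\in(\hat{\mathcal{G}}_L)^N$ and $\hat b\in(\hat{\mathcal{B}}_M)^N$, where $L,M\ge 0$ are constants large enough such that, for given $\varepsilon_1,\varepsilon_2>0$, there exist $\alpha^*\in(\mathcal{G}_L)^N$ and $b^*\in(\mathcal{B}_M)^N$ with $$\mathbb{E}[V_0(X)]\ge\sup_{b\in\mathcal{B}^N}\mathbb{E}\big[\tilde J_0(X,\alpha^*[b],b)\big]-\varepsilon_1\quad\text{and}\quad \mathbb{E}[V_0(X)]\le\mathbb{E}\big[\tilde J_0(X,\hat\alpha[b^*],b^* )\big]+\varepsilon_2 .$$ Let $\alpha^*$ and $b^*$ be such. Then there exist positive constants $C_L$ and $C_{L,M}$ (depending only on $L$, respectively on $L$ and $M$, and on the data) such that $$\mathbb{E}[\hat V_0(X)]-\mathbb{E}[V_0(X)]\le C_L\max_{0\le k\le N-1}d_{L^\infty(\Omega_N\times B)}(\alpha^*_k,\hat{\mathcal{G}}_L)+\eta_1+\varepsilon_1$$ and $$\mathbb{E}[\hat V_0(X)]-\mathbb{E}[V_0(X)]\ge-C_{L,M}\max_{0\le k\le N-1}d_{L^\infty(\Omega_N)}(b^*_k,\hat{\mathcal{B}}_M)-\eta_2-\varepsilon_2,$$ where $\Omega_N:=\{X^{a,b}_{k,x}:\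 x\in\Omega_0,\ 0\le k\le N,\ (a,b)\in A^N\times B^N\}$.
   Context: Let $T>0$, $N\ge1$, $\tau=T/N$. $A\subset\mathbb{R}^{n_A}$, $B\subset\mathbb{R}^{n_B}$ ($n_A,n_B\ge1$) are non-empty compact sets; $f:\mathbb{R}^d\times A\times B\to\mathbb{R}^d$, $g,\varphi:\mathbb{R}^d\to\mathbb{R}$ are Lipschitz continuous; $F(x,a,b)=x+\tau f(x,a,b)$. The ''data'' are $T,f,g,\varphi$. Write $p\vee q=\max(p,q)$ and $[\alpha]=\sup_{y\ne x}|\alpha(y)-\alpha(x)|/|y-x|$ for the Lipschitz constant of a function. $\mathrm{Meas}(X,Y)$ is the set of measurable functions from $X$ to $Y$; $\mathcal{G}=\mathrm{Meas}(\mathbb{R}^d\times B,A)$, $\mathcal{B}=\mathrm{Meas}(\mathbb{R}^d,B)$, $\mathcal{G}_L=\{\alpha\in\mathcal{G}:[\alpha]\le L\}$, $\mathcal{B}_M=\{b\in\mathcal{B}:[b]\le M\}$. For $a\in A^N,b\in B^N$: $X^{a,b}_{0,x}=x$, $X^{a,b}_{k+1,x}=F(X^{a,b}_{k,x},a_k,b_k)$, $J_0(x,a,b)=\big(\max_{0\le k\le N-1}g(X^{a,b}_{k,x})\big)\vee\varphi(X^{a,b}_{N,x})$. $V_0(x)=\inf_{\alpha\in S_N}\sup_{b\in B^N}J_0(x,\alpha[b],b)$, where $S_N$ is the set of measurable $\alpha:B^N\to A^N$ such that each component $\alpha_k$ depends only on $(b_0,\dots,b_k)$. For $\alpha\in\mathcal{G}^N$,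 $b\in\mathcal{B}^N$: $\tilde J_0(x,\alpha[b],b)=\big(\max_{0\le k\le N-1}g(\tilde x_k)\big)\vee\varphi(\tilde x_N)$ with $\tilde x_0=x$, $\tilde x_{k+1}=F(\tilde x_k,\alpha_k(\tilde x_k,b_k(\tilde x_k)),b_k(\tilde x_k))$. Algorithm 1 (global scheme): let $\hat{\mathcal{G}}\subset\mathcal{G}$, $\hat{\mathcal{B}}\subset\mathcal{B}$ be approximation spaces and $\eta_1,\eta_2>0$. The algorithm outputs $(\hat\alpha,\hat b)\in\hat{\mathcal{G}}^N\times\hat{\mathcal{B}}^N$ such that $$\sup_{b\in\hat{\mathcal{B}}^N}\mathbb{E}[\tilde J_0(X,\hat\alpha[b],b)]\le\inf_{\alpha\in\hat{\mathcal{G}}^N}\sup_{b\in\hat{\mathcal{B}}^N}\mathbb{E}[\tilde J_0(X,\alpha[b],b)]+\eta_1,$$ $$\mathbb{E}[\tilde J_0(X,\hat\alpha[\hat b],\hat b)]\ge\sup_{b\in\hat{\mathcal{B}}^N}\mathbb{E}[\tilde J_0(X,\hat\alpha[b],b)]-\eta_2,$$ and sets $\hat V_0(x):=\tilde J_0(x,\hat\alpha[\hat b],\hat b)$. $\hat{\mathcal{G}}_L=\hat{\mathcal{G}}\cap\mathcal{G}_L$ and $\hat{\mathcal{B}}_M=\hat{\mathcal{B}}\cap\mathcal{B}_M$. For a set $K$ and a family $\mathcal{H}$ of functions on it, $d_{L^\infty(K)}(h,\mathcal{H})=\inf_{h'\in\mathcal{H}}\|h-h'\|_{L^\infty(K)}$,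 with $\|\cdot\|_{L^\infty(K)}$ the supremum norm on $K$. *)

(* Defs.v *)
From HB Require Import structures.
From mathcomp Require Import all_boot all_order all_algebra.
From mathcomp Require Import all_classical all_reals all_analysis.

Set Implicit Arguments.
Unset Strict Implicit.
Unset Printing Implicit Defensive.

Import Order.TTheory GRing.Theory Num.Theory.
Import numFieldNormedType.Exports.

Local Open Scope classical_set_scope.
Local Open Scope ring_scope.

Notation borel T := (g_sigma_algebraType (@open T)).

(* The norm of the library on 'rV[R]_n is the sup norm and the one on products
   is the max of the norms; Lipschitz constants are taken here with respect to
   the Euclidean norms, on products too. *)
Section Euclidean.
Context {R : realType}.

Definition eucl_norm {n : nat} (x : 'rV[R]_n) : R :=
  Num.sqrt (\sum_(i < n) x ord0 i ^+ 2).

Definition eucl_dist {n : nat} (x y : 'rV[R]_n) : R := eucl_norm (y - x).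

Definition abs_dist (x y : R) : R := `|y - x|.

Definition prod_dist {U V : Type} (dU : U -> U -> R) (dV : V -> V -> R)
    (p q : U * V) : R :=
  Num.sqrt (dU p.1 q.1 ^+ 2 + dV p.2 q.2 ^+ 2).

Definition lip_const {U V : Type} (dU : U -> U -> R) (dV : V -> V -> R)
    (D : set U) (h : U -> V) : \bar R :=
  ereal_sup [set r | exists x y, [/\ D x, D y, y <> x &
                       r = (dV (h x) (h y) / dU x y)%:E]].

Definition dist_Linfty {U : Type} {n : nat} (K : set U) (h : U -> 'rV[R]_n)
    (H : set (U -> 'rV[R]_n)) : \bar R :=
  ereal_inf [set ereal_sup [set (eucl_norm (h z - h' z))%:E | z in K]
            | h' in H].

End Euclidean.

Definition pow {T : Type} (N : nat) (H : set T) : set ('I_N -> T) :=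
  [set h | forall k, H (h k)].

(* Elements of A^N for A a subset of R^n: matrices, whose k-th row is the k-th
   term, so that A^N carries the Borel sets of a finite-dimensional space. *)
Definition rowpow {R : realType} {n : nat} (N : nat) (A : set 'rV[R]_n) :
    set 'M[R]_(N, n) :=
  [set a | forall k, A (row k a)].

(* The k-th state, for k <= N; the state is frozen after time N. *)
Definition traj {E : Type} (N : nat) (step : 'I_N -> E -> E) (x : E) (k : nat)
    : E :=
  iteri k (fun j y => if insub j is Some i then step i y else y) x.

(* max (max_(k < N) g (z k)) (phi (z N)) *)
Definition running_cost {R : realType} {E : Type} (g phi : E -> R) (N : nat)
    (z : nat -> E) : R :=
  \big[Num.max/phi (z N)]_(k < N) g (z k).

Section Game.
Context {R : realType} {d nA nB : nat}.
Variables (A : set 'rV[R]_nA) (B : set 'rV[R]_nB).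
Variable f : 'rV[R]_d * 'rV[R]_nA * 'rV[R]_nB -> 'rV[R]_d.
Variables g phi : 'rV[R]_d -> R.
Variables (tau : R) (N : nat).

Definition F (x : 'rV[R]_d) (a : 'rV[R]_nA) (b : 'rV[R]_nB) : 'rV[R]_d :=
  x + tau *: f (x, a, b).

Definition state (a : 'M[R]_(N, nA)) (b : 'M[R]_(N, nB)) (x : 'rV[R]_d) :
    nat -> 'rV[R]_d :=
  traj (fun k y => F y (row k a) (row k b)) x.

Definition J0 (x : 'rV[R]_d) (a : 'M[R]_(N, nA)) (b : 'M[R]_(N, nB)) : R :=
  running_cost g phi N (state a b x).

Definition nonanticipative : set ('M[R]_(N, nB) -> 'M[R]_(N, nA)) :=
  [set alpha |
    [/\ forall b, rowpow B b -> rowpow A (alpha b),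
        measurable_fun (rowpow B : set (borel 'M[R]_(N, nB)))
          (alpha : borel 'M[R]_(N, nB) -> borel 'M[R]_(N, nA)) &
        forall (k : 'I_N) b b', rowpow B b -> rowpow B b' ->
          (forall j : 'I_N, (j <= k)%N -> row j b = row j b') ->
          row k (alpha b) = row k (alpha b')]].

Definition V0 (x : 'rV[R]_d) : \bar R :=
  ereal_inf [set ereal_sup [set (J0 x (alpha b) b)%:E | b in rowpow B]
            | alpha in nonanticipative].

(* Maps from R^d * B to A are represented by maps on R^d * R^nB of which only
   the restriction to R^d * B matters. *)
Definition Gfb : set ('rV[R]_d * 'rV[R]_nB -> 'rV[R]_nA) :=
  [set alpha |
    (forall z, (setT `*` B) z -> A (alpha z)) /\
    measurable_fun (setT `*` B : set (borel ('rV[R]_d * 'rV[R]_nB)%type))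
      (alpha : borel ('rV[R]_d * 'rV[R]_nB)%type -> borel 'rV[R]_nA)].

Definition Bfb : set ('rV[R]_d -> 'rV[R]_nB) :=
  [set b | (forall x, B (b x)) /\
           measurable_fun setT (b : borel 'rV[R]_d -> borel 'rV[R]_nB)].

Definition Glip (L : R) : set ('rV[R]_d * 'rV[R]_nB -> 'rV[R]_nA) :=
  Gfb `&`
  [set alpha |
    (lip_const (prod_dist eucl_dist eucl_dist) eucl_dist (setT `*` B) alpha
     <= L%:E)%E].

Definition Blip (M : R) : set ('rV[R]_d -> 'rV[R]_nB) :=
  Bfb `&` [set b | (lip_const eucl_dist eucl_dist setT b <= M%:E)%E].

Definition fstate (alpha : 'I_N -> 'rV[R]_d * 'rV[R]_nB -> 'rV[R]_nA)
    (b : 'I_N -> 'rV[R]_d -> 'rV[R]_nB) (x : 'rV[R]_d) : nat -> 'rV[R]_d :=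
  traj (fun k y => F y (alpha k (y, b k y)) (b k y)) x.

Definition Jtilde0 (x : 'rV[R]_d)
    (alpha : 'I_N -> 'rV[R]_d * 'rV[R]_nB -> 'rV[R]_nA)
    (b : 'I_N -> 'rV[R]_d -> 'rV[R]_nB) : R :=
  running_cost g phi N (fstate alpha b x).

Definition reachable (Omega0 : set 'rV[R]_d) : set 'rV[R]_d :=
  [set z | exists x k a b, [/\ Omega0 x, (k <= N)%N, rowpow A a, rowpow B b &
                             z = state a b x k]].

Section Random.
Context {dm : measure_display} {Om : measurableType dm}.
Variables (P : probability Om R) (X : Om -> 'rV[R]_d).

Definition EJtilde0 alpha b : \bar R :=
  'E_P[fun w => Jtilde0 (X w) alpha b].

Definition EV0 : \bar R := (\int[P]_w V0 (X w))%E.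

Definition algorithm_output
    (Ghat : set ('rV[R]_d * 'rV[R]_nB -> 'rV[R]_nA))
    (Bhat : set ('rV[R]_d -> 'rV[R]_nB)) (eta1 eta2 : R)
    (alphahat : 'I_N -> 'rV[R]_d * 'rV[R]_nB -> 'rV[R]_nA)
    (bhat : 'I_N -> 'rV[R]_d -> 'rV[R]_nB) : Prop :=
  [/\ pow Ghat alphahat, pow Bhat bhat,
      (ereal_sup [set EJtilde0 alphahat b | b in pow Bhat] <=
       ereal_inf [set ereal_sup [set EJtilde0 alpha b | b in pow Bhat]
                 | alpha in pow Ghat] + eta1%:E)%E &
      (EJtilde0 alphahat bhat >=
       ereal_sup [set EJtilde0 alphahat b | b in pow Bhat] - eta2%:E)%E].

End Random.
End Game.

Definition law_support {R : realType} {d : nat} {dm : measure_display}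
    {Om : measurableType dm} (P : probability Om R) (X : Om -> 'rV[R]_d) :
    set 'rV[R]_d :=
  [set x | forall U : set 'rV[R]_d, open U -> U x -> (0 < P (X @^-1` U))%E].

(* Main.v *)
Require Import Defs.
From HB Require Import structures.
From mathcomp Require Import all_boot all_order all_algebra.
From mathcomp Require Import all_classical all_reals all_analysis.
From mathcomp Require Import measurable_realfun ring lra.

(** Discrete Gronwall: if two trajectories of the Euler scheme use at each step
    controls that differ by at most a multiple of the distance of the states
    plus r, then, as N tau = T, they stay within T r exp(kappa T) of each other
    uniformly in N, and so do their costs.  For the lower bound all maps are
    Lipschitz and this applies directly.

    For the upper bound the opponent's feedback b is merely measurable, so the
    trajectories under (alpha, b) and (alpha*, b) may separate.  One freezes the
    controls b takes along the first trajectory and replaces them by points of a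
    finite net of the compact set B; against alpha* this open-loop sequence
    costs at most as much as the feedback b' obtained by dynamic programming
    over the net, which is measurable and whose cost is Lipschitz in the initial
    state. *)

Set Implicit Arguments.
Unset Strict Implicit.
Unset Printing Implicit Defensive.

Import Order.TTheory GRing.Theory Num.Theory.
Import numFieldNormedType.Exports.

Local Open Scope classical_set_scope.
Local Open Scope ring_scope.

(** * Euclidean norm and distance; Lipschitz bounds in division-free form *)

Section EuclideanDistance.
Context {R : realType}.

Definition lip_with {U V : Type} (dU : U -> U -> R) (dV : V -> V -> R)
    (D : set U) (K : R) (h : U -> V) : Prop :=
  forall x y, D x -> D y -> dV (h x) (h y) <= K * dU x y.

Lemma sqrt_sqrD_le (u v : R) : 0 <= u -> 0 <= v ->
  Num.sqrt (u ^+ 2 + v ^+ 2) <= u + v.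
Proof.
move=> u0 v0; rewrite -[leRHS]ger0_norm ?addr_ge0 // -sqrtr_sqr.
by apply: ler_wsqrtr; nra.
Qed.

Section Norm.
Context {n : nat}.
Implicit Types x y z : 'rV[R]_n.

Lemma eucl_norm_ge0 x : 0 <= eucl_norm x.
Proof. exact: sqrtr_ge0. Qed.

Lemma eucl_norm_sqr x : eucl_norm x ^+ 2 = \sum_(i < n) x ord0 i ^+ 2.
Proof. by rewrite sqr_sqrtr // sumr_ge0 // => i _; exact: sqr_ge0. Qed.

Lemma coord_le_eucl_norm x i : `|x ord0 i| <= eucl_norm x.
Proof.
rewrite -sqrtr_sqr; apply: ler_wsqrtr.
by rewrite (bigD1 i) //= lerDl sumr_ge0 // => j _; exact: sqr_ge0.
Qed.

Lemma eucl_norm_eq0 x : eucl_norm x = 0 -> x = 0.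
Proof.
move=> x0; apply/rowP => i; rewrite mxE; apply/eqP; rewrite -normr_le0 -x0.
exact: coord_le_eucl_norm.
Qed.

Lemma eucl_normZ (a : R) x : eucl_norm (a *: x) = `|a| * eucl_norm x.
Proof.
rewrite /eucl_norm -[`|a|]sqrtr_sqr -sqrtrM ?sqr_ge0 // mulr_sumr.
by congr Num.sqrt; apply: eq_bigr => i _; rewrite mxE exprMn.
Qed.

(** Cauchy-Schwarz. With [a] and [b] the norms of [x] and [y], the sum of squares of the coordinates
    of [b x - a y] equals [2ab (ab - s)], and [ab > 0] once null vectors are set apart. *)
Lemma inner_le_eucl_norm x y :
  \sum_(i < n) x ord0 i * y ord0 i <= eucl_norm x * eucl_norm y.
Proof.
have := eucl_norm_ge0 x; have := eucl_norm_ge0 y.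
rewrite !le_eqVlt => /predU1P[/esym/eucl_norm_eq0 ->|y0].
  rewrite big1 => [|i _]; last by rewrite mxE mulr0.
  by move=> _; rewrite -le_eqVlt mulr_ge0 ?eucl_norm_ge0.
move=> /predU1P[/esym/eucl_norm_eq0 ->|x0].
  rewrite big1 => [|i _]; last by rewrite mxE mul0r.
  by rewrite -le_eqVlt mulr_ge0 ?eucl_norm_ge0.
rewrite -le_eqVlt.
set a := eucl_norm x in x0 *; set b := eucl_norm y in y0 *.
set s := \sum_(i < n) _.
have : 0 <= \sum_(i < n) (b * x ord0 i - a * y ord0 i) ^+ 2.
  by rewrite sumr_ge0 // => i _; exact: sqr_ge0.
have -> : \sum_(i < n) (b * x ord0 i - a * y ord0 i) ^+ 2 =
    2 * (a * b) * (a * b - s).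
  transitivity (b ^+ 2 * a ^+ 2 - 2 * a * b * s + a ^+ 2 * b ^+ 2);
    last by ring.
  rewrite [in X in X - _ + _](eucl_norm_sqr x) [in X in _ + X](eucl_norm_sqr y).
  rewrite !mulr_sumr -sumrB -big_split /=.
  by apply: eq_bigr => i _; ring.
by rewrite pmulr_rge0 ?subr_ge0 // mulr_gt0 ?mulr_gt0.
Qed.

Lemma ler_eucl_normD x y : eucl_norm (x + y) <= eucl_norm x + eucl_norm y.
Proof.
rewrite -(@ler_pXn2r _ 2) ?nnegrE ?addr_ge0 ?eucl_norm_ge0 //.
rewrite sqrrD !eucl_norm_sqr.
under eq_bigr do rewrite mxE sqrrD.
rewrite !big_split /= lerD2r lerD2l mulr2n.
by rewrite lerD // inner_le_eucl_norm.
Qed.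

(** The factor [n] is cruder than its square root, but it is only used to pass from sup-norm balls
    to Euclidean distances. *)
Lemma eucl_norm_le_coord x (r : R) :
  (forall i, `|x ord0 i| <= r) -> eucl_norm x <= n%:R * r.
Proof.
case: n x => [|m] x xr.
  by rewrite /eucl_norm big_ord0 sqrtr0 mul0r.
have r0 : 0 <= r by exact: le_trans (xr ord0).
rewrite -[leRHS]ger0_norm ?mulr_ge0 // -sqrtr_sqr; apply: ler_wsqrtr.
apply: (@le_trans _ _ (\sum_(i < m.+1) r ^+ 2)).
  by apply: ler_sum => i _; rewrite -real_normK ?num_real // lerXn2r ?nnegrE.
rewrite sumr_const card_ord -[leLHS]mulr_natl exprMn ler_wpM2r ?sqr_ge0 //.
by rewrite -natrX ler_nat leq_pmull.
Qed.

Lemma eucl_dist_ge0 x y : 0 <= eucl_dist x y.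
Proof. exact: eucl_norm_ge0. Qed.

Lemma eucl_distxx x : eucl_dist x x = 0.
Proof.
rewrite /eucl_dist subrr /eucl_norm big1 ?sqrtr0 // => i _.
by rewrite mxE expr0n.
Qed.

Lemma eucl_dist_gt0 x y : y <> x -> 0 < eucl_dist x y.
Proof.
move=> yx; rewrite lt_neqAle eucl_dist_ge0 andbT eq_sym; apply/eqP.
by move=> /eucl_norm_eq0/eqP; rewrite subr_eq0 => /eqP.
Qed.

Lemma eucl_dist_triangle z x y :
  eucl_dist x y <= eucl_dist x z + eucl_dist z y.
Proof.
have := ler_eucl_normD (z - x) (y - z).
by rewrite [z - x + _]addrC addrA subrK.
Qed.

Lemma eucl_distC x y : eucl_dist x y = eucl_dist y x.
Proof. by rewrite /eucl_dist -opprB -scaleN1r eucl_normZ normrN1 mul1r. Qed.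

End Norm.

Lemma prod_dist_gt0 {U V : Type} (dU : U -> U -> R) (dV : V -> V -> R) :
  (forall x y, y <> x -> 0 < dU x y) -> (forall x y, y <> x -> 0 < dV x y) ->
  forall p q, q <> p -> 0 < prod_dist dU dV p q.
Proof.
move=> dU0 dV0 [u v] [u' v'] qp; rewrite sqrtr_gt0 /=.
have [uu|uu] := pselect (u' = u).
  rewrite ltr_wpDl ?sqr_ge0 // exprn_gt0 // dV0 // => vv.
  by apply: qp; rewrite uu vv.
by rewrite ltr_wpDr ?sqr_ge0 // exprn_gt0 // dU0.
Qed.

(** The supremum ranges over pairs of distinct points, so the diagonal is handled apart, with
    [0 <= K]. *)
Lemma lip_const_le {U V : Type} (dU : U -> U -> R) (dV : V -> V -> R)
    (D : set U) (h : U -> V) (K : R) :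
  (forall x y, y <> x -> 0 < dU x y) -> (forall x, 0 <= dU x x) ->
  (forall x, dV x x = 0) -> 0 <= K ->
  (lip_const dU dV D h <= K%:E)%E -> lip_with dU dV D K h.
Proof.
move=> dU0 dUxx dVxx K0 hK x y Dx Dy; have [->|yx] := pselect (y = x).
  by rewrite dVxx mulr_ge0.
rewrite -ler_pdivrMr ?dU0 // -lee_fin; apply: le_trans hK.
by apply: ereal_sup_ubound; exists x, y.
Qed.

Lemma lip_const_lty {U V : Type} (dU : U -> U -> R) (dV : V -> V -> R)
    (D : set U) (h : U -> V) :
  (forall x y, y <> x -> 0 < dU x y) -> (forall x, 0 <= dU x x) ->
  (forall x, dV x x = 0) ->
  (lip_const dU dV D h < +oo)%E -> exists2 K, 0 <= K & lip_with dU dV D K h.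
Proof.
move=> dU0 dUxx dVxx hy.
(* The maximum with 0 covers a supremum over no pair of points, which is [-oo]. *)
exists (Num.max 0 (fine (lip_const dU dV D h))); first by rewrite le_max lexx.
apply: lip_const_le => //; first by rewrite le_max lexx.
case: (lip_const _ _ _ _) hy => [r| |] //= _; last by rewrite leNye.
by rewrite lee_fin le_max lexx orbT.
Qed.

End EuclideanDistance.

(** * Trajectories of a scheme, their costs, and discrete Gronwall *)

Section Trajectories.
Context {R : realType}.

Section Traj.
Context {E : Type}.

Lemma traj_succ N (step : 'I_N -> E -> E) x k :
  traj step x k.+1 =
  if insub k is Some i then step i (traj step x k) else traj step x k.
Proof. by []. Qed.

Lemma trajS N (step : 'I_N -> E -> E) x (i : 'I_N) :
  traj step x i.+1 = step i (traj step x i).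
Proof. by rewrite traj_succ valK. Qed.

(** Splits off the first step, whereas the definition splits off the last one; dynamic programming
    needs this form. *)
Lemma traj_shift N (step : 'I_N.+1 -> E -> E) x k :
  traj step x k.+1 = traj (step \o lift ord0) (step ord0 x) k.
Proof.
elim: k => [|k IH].
  by rewrite traj_succ insubT; congr (step _ x); exact: val_inj.
rewrite traj_succ IH traj_succ.
have [kN|Nk] := ltnP k N; last by rewrite !insubF // ltnNge ?ltnS ?Nk.
by rewrite !insubT /=; congr (step _ _); exact: val_inj.
Qed.

(** Agreement along one trajectory suffices, which lets a feedback be exchanged for the open-loop
    controls that it generates. *)
Lemma eq_traj N (step step' : 'I_N -> E -> E) x :
  (forall i : 'I_N, step i (traj step x i) = step' i (traj step x i)) ->
  forall k, traj step x k = traj step' x k.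
Proof.
move=> eq_step; elim=> // k IH; rewrite !traj_succ -IH.
have [kN|Nk] := ltnP k N; last by rewrite insubF // ltnNge Nk.
by rewrite insubT; exact: eq_step (Ordinal kN).
Qed.

Variables g phi : E -> R.

Lemma running_cost_traj_recl N (step : 'I_N.+1 -> E -> E) x :
  running_cost g phi N.+1 (traj step x) =
  Num.max (g x)
    (running_cost g phi N (traj (step \o lift ord0) (step ord0 x))).
Proof.
rewrite /running_cost big_ord_recl traj_shift; congr Num.max.
by apply: eq_bigr => i _; rewrite lift0 traj_shift.
Qed.

Lemma running_cost_leD N (z z' : nat -> E) c :
  (forall k, (k < N)%N -> g (z k) <= g (z' k) + c) ->
  phi (z N) <= phi (z' N) + c ->
  running_cost g phi N z <= running_cost g phi N z' + c.
Proof.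
move=> gz phiz; apply: bigmax_le => [|i _].
  by apply: le_trans phiz _; rewrite lerD2r bigmax_ge_id.
by apply: le_trans (gz _ (ltn_ord i)) _; rewrite lerD2r le_bigmax.
Qed.

End Traj.

Section Lipschitz.
Context {d : nat}.
Implicit Types x y : 'rV[R]_d.
Local Notation E := 'rV[R]_d.

(** Each step multiplies the gap by [q] and adds [r], and [r <= q ^+ k.+1 * r] as [1 <= q]. The step
    bound is only asked at the states visited, since the steps may come from discontinuous
    feedbacks. *)
Lemma traj_gronwall N (s t : 'I_N -> E -> E) x (q r : R) :
  1 <= q -> 0 <= r ->
  (forall i : 'I_N, eucl_dist (s i (traj s x i)) (t i (traj t x i)) <=
                    q * eucl_dist (traj s x i) (traj t x i) + r) ->
  forall k, (k <= N)%N ->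
    eucl_dist (traj s x k) (traj t x k) <= q ^+ k * (k%:R * r).
Proof.
move=> q1 r0 st; elim=> [|k IH] kN.
  by rewrite mul0r mulr0 /traj /= eucl_distxx.
rewrite (trajS s x (Ordinal kN)) (trajS t x (Ordinal kN)).
apply: le_trans (st (Ordinal kN)) _.
apply: (@le_trans _ _ (q * (q ^+ k * (k%:R * r)) + r)).
  by rewrite lerD2r ler_wpM2l ?(le_trans ler01) // IH // ltnW.
rewrite mulrA -exprS -natr1 mulrDl mul1r mulrDr lerD2l.
by rewrite ler_peMl // exprn_ege1.
Qed.

Definition eucl_lipschitz (h : E -> R) : Prop :=
  exists2 K, 0 <= K & lip_with eucl_dist abs_dist setT K h.

Lemma lip_with_le (h : E -> R) K x y :
  lip_with eucl_dist abs_dist setT K h -> h x <= h y + K * eucl_dist x y.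
Proof.
move=> hK; rewrite -lerBlDl; apply: le_trans (hK x y I I).
by rewrite /abs_dist distrC ler_norm.
Qed.

Lemma lip_withP (h : E -> R) K :
  (forall x y, h x <= h y + K * eucl_dist x y) ->
  lip_with eucl_dist abs_dist setT K h.
Proof.
move=> hK x y _ _; rewrite /abs_dist ler_norml lerBrDl.
have := hK x y; have := hK y x; rewrite eucl_distC; lra.
Qed.

Lemma eucl_lipschitz_max (h h' : E -> R) :
  eucl_lipschitz h -> eucl_lipschitz h' ->
  eucl_lipschitz (fun x => Num.max (h x) (h' x)).
Proof.
move=> [K K0 hK] [K' K'0 hK']; exists (K + K'); first exact: addr_ge0.
apply: lip_withP => x y; have := eucl_dist_ge0 x y.
have := lip_with_le x y hK; have := lip_with_le x y hK'.
rewrite ge_max => h1 h2 xy; apply/andP; split.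
  by apply: le_trans h2 _; rewrite lerD ?le_max ?lexx // ler_wpM2r // lerDl.
by apply: le_trans h1 _; rewrite lerD ?le_max ?lexx ?orbT // ler_wpM2r // lerDr.
Qed.

Lemma eucl_lipschitz_comp (h : E -> R) (s : E -> E) :
  eucl_lipschitz h ->
  (exists2 K, 0 <= K & lip_with eucl_dist eucl_dist setT K s) ->
  eucl_lipschitz (h \o s).
Proof.
move=> [K K0 hK] [K' K'0 sK']; exists (K * K'); first exact: mulr_ge0.
move=> x y _ _; apply: le_trans (hK _ _ I I) _.
by rewrite -mulrA ler_wpM2l // sK'.
Qed.

Lemma eucl_lipschitzB (h h' : E -> R) :
  eucl_lipschitz h -> eucl_lipschitz h' -> eucl_lipschitz (fun x => h x - h' x).
Proof.
move=> [K K0 hK] [K' K'0 hK']; exists (K + K'); first exact: addr_ge0.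
apply: lip_withP => x y; rewrite mulrDl.
have := lip_with_le x y hK; have := lip_with_le y x hK'.
rewrite eucl_distC; lra.
Qed.

Lemma running_cost_lipschitz (g phi : E -> R) N (step : 'I_N -> E -> E) :
  eucl_lipschitz g -> eucl_lipschitz phi ->
  (forall i, exists2 K, 0 <= K &
    lip_with eucl_dist eucl_dist setT K (step i)) ->
  eucl_lipschitz (fun x => running_cost g phi N (traj step x)).
Proof.
move=> gL phiL; elim: N step => [|N IH] step stepL.
  by under [X in eucl_lipschitz X]eq_fun do rewrite /running_cost big_ord0.
under [X in eucl_lipschitz X]eq_fun do rewrite running_cost_traj_recl.
apply: eucl_lipschitz_max => //.
apply: (@eucl_lipschitz_comp
  (fun y => running_cost g phi N (traj (step \o lift ord0) y))) => //.
by apply: IH => i; exact: stepL.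
Qed.

End Lipschitz.
End Trajectories.

(** * Borel measurability, maximising feedbacks and finite nets *)

Section Borel.
Context {R : realType} {d : nat}.
Local Notation E := 'rV[R]_d.

Lemma ball_eucl_dist (x y : E) (e : R) :
  ball x e y -> eucl_dist x y <= d%:R * e.
Proof.
move=> [_ xy]; apply: eucl_norm_le_coord => i; rewrite !mxE distrC.
exact/ltW/xy.
Qed.

Lemma open_eucl_lipschitz_lt (h : E -> R) (r : R) :
  eucl_lipschitz h -> open [set x | h x < r].
Proof.
move=> [K K0 hK]; rewrite openE => x /= hxr; apply/nbhs_ballP.
have Kd0 : 0 < K * d%:R + 1 by rewrite ltr_wpDl // mulr_ge0.
(* A sup-norm ball of radius [e] has Euclidean radius at most [d e], so [h] grows by at most [K d e]
   on it; the [+ 1] keeps the denominator positive and the bound strict. *)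
exists ((r - h x) / (K * d%:R + 1)) => /=.
  by rewrite divr_gt0 // subr_gt0.
move=> y /ball_eucl_dist xy /=.
apply: le_lt_trans (lip_with_le y x hK) _; rewrite eucl_distC -ltrBrDl.
apply: le_lt_trans (ler_wpM2l K0 xy) _; rewrite (mulrA K) mulrCA.
by rewrite gtr_pMr ?subr_gt0 // ltr_pdivrMr // mul1r ltrDl.
Qed.

Lemma borel_open (U : set E) : open U -> measurable (U : set (borel E)).
Proof. exact: sub_sigma_algebra. Qed.

Lemma measurable_eucl_lipschitz (h : E -> R) :
  eucl_lipschitz h -> measurable_fun setT (h : borel E -> R).
Proof.
move=> hL; apply: (measurability _ (RGenInftyO.measurableE R)).
move=> _ [_ [r ->] <-]; rewrite setTI; apply: borel_open.
have -> : h @^-1` `]-oo, r[%classic = [set x | h x < r].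
  by apply/seteqP; split => x /=; rewrite in_itv.
exact: open_eucl_lipschitz_lt.
Qed.

(** Induction on the list: switch to the new candidate where it is strictly better than the current
    selection. The selection may jump but its value, a maximum of Lipschitz functions, is Lipschitz;
    hence the switching set is open and measurability survives. *)
Lemma measurable_argmax {n} (C : seq 'rV[R]_n) (h : 'rV[R]_n -> E -> R) :
  C != [::] -> (forall c, c \in C -> eucl_lipschitz (h c)) ->
  exists b : E -> 'rV[R]_n,
    [/\ measurable_fun setT (b : borel E -> borel 'rV[R]_n),
        forall x, b x \in C,
        eucl_lipschitz (fun x => h (b x) x) &
        forall c x, c \in C -> h c x <= h (b x) x].
Proof.
elim: C => // c C IH _ hL.
have hcL : eucl_lipschitz (h c) by apply: hL; rewrite mem_head.
have [->|C0] := eqVneq C [::].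
  exists (fun=> c); split => //.
    by move=> x; rewrite mem_seq1.
  by move=> c' x; rewrite mem_seq1 => /eqP ->.
have [|b [mb bC bL bmax]] := IH C0.
  by move=> c' c'C; apply: hL; rewrite inE c'C orbT.
exists (fun x => if h (b x) x - h c x < 0 then c else b x).
have hE x : h (if h (b x) x - h c x < 0 then c else b x) x =
    Num.max (h c x) (h (b x) x).
  by rewrite subr_lt0; case: ltP.
split.
- apply: (@measurable_fun_ifT _ _ (borel E) (borel 'rV[R]_n)) => //.
  apply: (measurable_fun_bool true); rewrite setTI.
  have -> : (fun x => h (b x) x - h c x < 0) @^-1` [set true] =
    [set x | h (b x) x - h c x < 0] by [].
  by apply: borel_open; apply: open_eucl_lipschitz_lt; exact: eucl_lipschitzB.
- by move=> x; case: ifP => _; rewrite inE ?eqxx // bC orbT.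
- under [X in eucl_lipschitz X]eq_fun do rewrite hE.
  exact: eucl_lipschitz_max.
- move=> c' x; rewrite hE inE le_max => /predU1P[->|c'C]; first by rewrite lexx.
  by rewrite bmax ?orbT.
Qed.

(** Dynamic programming with controls in a finite set. The optimal cost of the remaining steps is
    Lipschitz by induction, so [measurable_argmax] applies to the first step. A single feedback thus
    dominates the open-loop sequences from all initial states at once. *)
Lemma feedback_argmax {n} (g phi : E -> R) (C : seq 'rV[R]_n) N
    (step : 'I_N -> 'rV[R]_n -> E -> E) :
  eucl_lipschitz g -> eucl_lipschitz phi -> C != [::] ->
  (forall k c, c \in C ->
    exists2 K, 0 <= K & lip_with eucl_dist eucl_dist setT K (step k c)) ->
  exists b : 'I_N -> E -> 'rV[R]_n,
    [/\ forall k, measurable_fun setT (b k : borel E -> borel 'rV[R]_n),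
        forall k x, b k x \in C,
        eucl_lipschitz (fun x => running_cost g phi N
          (traj (fun k y => step k (b k y) y) x)) &
        forall (c : 'I_N -> 'rV[R]_n) x, (forall k, c k \in C) ->
          running_cost g phi N (traj (fun k => step k (c k)) x) <=
          running_cost g phi N (traj (fun k y => step k (b k y) y) x)].
Proof.
move=> gL phiL C0; elim: N step => [|N IH] step stepL.
  exists (fun=> cst 0); split; try by case.
    by under [X in eucl_lipschitz X]eq_fun do rewrite /running_cost big_ord0.
  by move=> c x _; rewrite /running_cost !big_ord0.
have [|b [mb bC bL bmax]] := IH (step \o lift ord0).
  by move=> k c cC; exact: stepL.
(* [W] is the optimal cost after the first step; [b0] maximises it over the images of the first
   step. *)
pose W x := running_cost g phi N
  (traj (fun k y => step (lift ord0 k) (b k y) y) x).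
have [|b0 [mb0 b0C b0L b0max]] :=
    measurable_argmax (h := fun c x => W (step ord0 c x)) C0.
  by move=> c cC; apply: (@eucl_lipschitz_comp _ _ W) => //; exact: stepL.
pose b' k := if unlift ord0 k is Some j then b j else b0.
have b'0 : b' ord0 = b0 by rewrite /b' unlift_none.
have b'l j : b' (lift ord0 j) = b j by rewrite /b' liftK.
have b'E x : running_cost g phi N.+1 (traj (fun k y => step k (b' k y) y) x) =
    Num.max (g x) (W (step ord0 (b0 x) x)).
  rewrite running_cost_traj_recl b'0; congr Num.max.
  rewrite /W; congr running_cost; congr traj; apply/funext => j /=.
  by rewrite b'l.
exists b'; split.
- by move=> k; rewrite /b'; case: unliftP.
- by move=> k x; rewrite /b'; case: unliftP.
- under [X in eucl_lipschitz X]eq_fun do rewrite b'E.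
  exact: eucl_lipschitz_max.
- move=> c x cC; rewrite b'E running_cost_traj_recl.
  rewrite ge_max le_max lexx /= le_max; apply/orP; right.
  apply: le_trans (b0max (c ord0) x (cC _)).
  by apply: (bmax (c \o lift ord0)) => k; exact: cC.
Qed.

Lemma compact_eucl_net (B : set E) (rho : R) :
  compact B -> B !=set0 -> 0 < rho ->
  exists C : seq E, [/\ C != [::], forall c, c \in C -> B c &
    forall b, B b -> exists2 c, c \in C & eucl_dist b c <= rho].
Proof.
move=> + [b0 Bb0] rho0; rewrite compact_cover => Bcover.
(* A sup-norm ball of this radius has Euclidean radius at most [rho]; [d.+1] rather than [d] covers
   dimension 0. *)
have e0 : 0 < rho / d.+1%:R by rewrite divr_gt0.
have [|b Bb|D DB BD] := Bcover E B (fun c => (ball c (rho / d.+1%:R))^°).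
- by move=> c _; exact: open_interior.
- by exists b => //; exact: nbhsx_ballx.
have net b : B b -> exists2 c, c \in finmap.enum_fset D & eucl_dist b c <= rho.
  move=> /BD[c cD /interior_subset bc]; exists c => //.
  rewrite eucl_distC; apply: le_trans (ball_eucl_dist bc) _.
  by rewrite mulrCA ger_pMr // ler_pdivrMr // mul1r ler_nat.
exists (finmap.enum_fset D); split => //.
- by have [c] := net _ Bb0; case: (finmap.enum_fset D).
- by move=> c /DB; rewrite inE.
Qed.

End Borel.

(** * Expectations of possibly non-measurable costs, and the support of a law *)

Section Expectation.
Context {R : realType} {dm : measure_display} {Om : measurableType dm}.
Variable P : probability Om R.
Local Open Scope ereal_scope.

(* The integral of a function that is not measurable is a difference of lower
   integrals: it is still monotone.  This spares the measurability of the cost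
   under feedbacks that are merely measurable. *)
Lemma le_integral_lower (f g : Om -> \bar R) :
  (forall w, f w <= g w) -> \int[P]_w f w <= \int[P]_w g w.
Proof.
move=> fg; rewrite [leLHS]integralE [leRHS]integralE.
have le_ge0 (u v : Om -> \bar R) : (forall w, 0 <= u w) ->
    (forall w, u w <= v w) -> \int[P]_w u w <= \int[P]_w v w.
  move=> u0 uv; rewrite !ge0_integralTE //; last first.
    by move=> w; exact: le_trans (uv w).
  apply: le_ereal_sup => _ /= [h hu <-]; exists h => // w.
  exact: le_trans (hu w) (uv w).
apply: leeB; apply: le_ge0 => w.
- exact: funepos_ge0.
- by apply: (@funepos_le _ _ setT) => [v _|]; rewrite ?inE.
- exact: funeneg_ge0.
- by apply: (@funeneg_le _ _ setT) => [v _|]; rewrite ?inE.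
Qed.

Lemma expectation_le_as (D : set Om) (f g : Om -> R) :
  measurable D -> P (~` D) = 0 -> measurable_fun setT g ->
  (forall w, D w -> (f w <= g w)%R) -> 'E_P[f] <= 'E_P[g].
Proof.
move=> mD PD mg fg; rewrite unlock.
(* Raising [g] to [+oo] off [D] keeps its integral and makes the inequality hold everywhere, as
   [le_integral_lower] requires. Nothing is asked of the measurability of [f]. *)
pose g' w := if w \in D then (g w)%:E else +oo.
have -> : \int[P]_w (g w)%:E = \int[P]_w g' w.
  apply: ae_eq_integral => //; first exact/measurable_EFinP.
    apply: measurable_fun_ifT => //; last exact/measurable_EFinP.
    apply: (measurable_fun_bool true); rewrite setTI.
    by have -> : (fun w => w \in D) @^-1` [set true] = D
      by apply/seteqP; split => w /=; [exact: set_mem|exact: mem_set].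
  exists (~` D); split => //; first exact: measurableC.
  by move=> w /= + Dw; apply => _; rewrite /g' mem_set.
apply: le_integral_lower => w; rewrite /g'; case: ifPn => [|_].
  by rewrite inE lee_fin; exact: fg.
exact: leey.
Qed.

Context {d : nat}.
Variable X : Om -> 'rV[R]_d.
Hypothesis mX : measurable_fun setT (X : Om -> borel 'rV[R]_d).

Lemma measurable_lipschitz_comp (h : 'rV[R]_d -> R) :
  eucl_lipschitz h -> measurable_fun setT (h \o X).
Proof.
move=> hL; apply: (@measurableT_comp _ _ _ _ (borel 'rV[R]_d)) => //.
exact: measurable_eucl_lipschitz.
Qed.

Lemma eucl_norm_lipschitz : eucl_lipschitz (@eucl_norm R d).
Proof.
exists 1%R => //; apply: lip_withP => x y; rewrite mul1r eucl_distC.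
by have := ler_eucl_normD y (x - y); rewrite addrC subrK.
Qed.

Lemma Lfun1_lipschitz_comp (h : 'rV[R]_d -> R) :
  'E_P[fun w => eucl_norm (X w)] < +oo -> eucl_lipschitz h ->
  h \o X \in Lfun P 1.
Proof.
move=> EX [K K0 hK]; apply/Lfun1_integrable.
have iX : P.-integrable setT (fun w => (eucl_norm (X w))%:E).
  apply/integrableP; split.
    apply/measurable_EFinP.
    exact: measurable_lipschitz_comp eucl_norm_lipschitz.
  move: EX; rewrite unlock; congr (_ < _); apply: eq_integral => w _.
  by rewrite gee0_abs // lee_fin eucl_norm_ge0.
(* The dominating function is [|h 0| + K |X|]. *)
have iKX := integrableD measurableT
  (finite_measure_integrable_cst P `|h 0%R| measurableT)
  (integrableZl measurableT K iX).
apply: le_integrable iKX => //.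
  by apply/measurable_EFinP; apply: measurable_lipschitz_comp; exists K.
move=> w _ /=; rewrite lee_fin [leRHS]ger0_norm; last first.
  by rewrite addr_ge0 // mulr_ge0 // eucl_norm_ge0.
have := hK 0%R (X w) I I; rewrite /abs_dist /eucl_dist subr0 => hX.
rewrite -[h (X w)](subrK (h 0%R)) (le_trans (ler_normD _ _)) //.
by rewrite [leRHS]addrC lerD2r.
Qed.

Lemma expectationDc (f : Om -> R) (c : R) : f \in Lfun P 1 ->
  'E_P[fun w => (f w + c)%R] = 'E_P[f] + c%:E.
Proof.
move=> fL; have := expectationD (Y := cst c) fL; rewrite expectation_cst; apply.
by apply/Lfun1_integrable; exact: finite_measure_integrable_cst.
Qed.

(** A countable base of the topology: rational centres, inverse-integer radii. *)
Definition rational_box (p : 'rV[rat]_d * nat) : set 'rV[R]_d :=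
  (ball (map_mx (@ratr R) p.1) (p.2.+1%:R^-1 : R)%R)^°.

Lemma rational_box_nbhs (U : set 'rV[R]_d) x : open U -> U x ->
  exists2 p, rational_box p x & rational_box p `<=` U.
Proof.
rewrite openE => oU Ux; have /nbhs_ballP[e /= e0 eU] := oU _ Ux.
have [n _ ne] : exists2 n : nat, true & ((n.+1%:R)^-1 < e / 2)%R.
  have := near_infty_natSinv_lt (PosNum (divr_gt0 e0 (ltr0Sn R 1))).
  by move=> [n _ /(_ n (leqnn _)) ne]; exists n.
set r : R := (n.+1%:R^-1)%R in ne; have r0 : (0 < r)%R by rewrite invr_gt0.
have r20 : (0 < r / 2)%R by rewrite divr_gt0.
have /choice[q qx] (i : 'I_d) :
    exists q : rat, (`|ratr q - x ord0 i| < r / 2)%R.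
  have [q] := @rat_in_itvoo R (x ord0 i - r / 2) (x ord0 i + r / 2) ltac:(lra).
  by rewrite in_itv /= -ltr_distl => qr; exists q.
set c := map_mx (@ratr R) (\row_i q i)%R.
have cx : ball c (r / 2) x by split => // i j; rewrite !mxE ord1; exact: qx.
exists ((\row_i q i)%R, n); rewrite /rational_box /= -/r -/c.
- apply: (@filterS _ _ _ (ball x (r / 2))); last exact: nbhsx_ballx.
  by move=> y xy; rewrite [r]splitr; exact: ball_triangle xy.
- move=> y /interior_subset cy; apply: eU.
  have cx' : ball c (e / 2) x by apply: le_ball cx; lra.
  rewrite [e]splitr; apply: ball_triangle (ball_sym cx') _.
  exact: le_ball (ltW ne) _ cy.
Qed.

(** A point off the support has a null open neighbourhood, hence lies in a null rational box. The
    complement is therefore the union of the countably many null boxes. *)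
Lemma law_support_conull :
  measurable (X @^-1` law_support P X) /\ P (~` (X @^-1` law_support P X)) = 0.
Proof.
(* [G] enumerates the null boxes, with the empty set for every other index. *)
pose G n := if unpickle n is Some p then
  if P (X @^-1` rational_box p) == 0 then rational_box p else set0 else set0.
have mbox p : measurable (X @^-1` rational_box p).
  rewrite -[X @^-1` _]setTI; apply: mX => //.
  by apply: borel_open; exact: open_interior.
have mG n : measurable (X @^-1` G n).
  rewrite /G; case: unpickle => [p|]; last by rewrite preimage_set0.
  by case: ifP => _; rewrite ?preimage_set0.
have suppE : ~` (X @^-1` law_support P X) = \bigcup_n (X @^-1` G n).
  apply/seteqP; split => w /=.
    move=> /existsNP[U] /not_implyP[oU] /not_implyP[Uw /negP].
    rewrite -leNgt => PU; have [p pw pU] := rational_box_nbhs oU Uw.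
    exists (pickle p) => //=; rewrite /G pickleK; case: ifPn => // /negP; case.
    rewrite eq_le measure_ge0 andbT; apply: le_trans PU; apply: le_measure.
    - by rewrite inE.
    - by rewrite inE -[X @^-1` _]setTI; apply: mX => //; exact: borel_open.
    - by move=> v; exact: pU.
  move=> [n _ /=]; rewrite /G; case: unpickle => // p.
  case: ifPn => // /eqP P0 pw.
  by move=> /(_ _ (@open_interior _ _) pw); rewrite P0 ltxx.
have mC : measurable (~` (X @^-1` law_support P X)).
  by rewrite suppE; exact: bigcupT_measurable.
split; first by rewrite -[X in measurable X]setCK; exact: measurableC.
apply/negligibleP => //; rewrite suppE; apply: negligible_bigcup => n.
apply/negligibleP => //; rewrite /G.
case: unpickle => [p|]; last by rewrite preimage_set0.
by case: ifPn => [/eqP //|_]; rewrite preimage_set0.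
Qed.

End Expectation.

(** * Stability of the cost under changes of strategy and of control *)

Section Comparison.
Context {R : realType} {d nA nB : nat} (A : set 'rV[R]_nA) (B : set 'rV[R]_nB)
  (f : 'rV[R]_d * 'rV[R]_nA * 'rV[R]_nB -> 'rV[R]_d) (g phi : 'rV[R]_d -> R)
  (tau T : R) (N : nat) (Kf Kg : R).
Hypotheses (tau0 : 0 <= tau) (NtauT : N%:R * tau <= T).
Hypotheses (Kf0 : 0 <= Kf) (Kg0 : 0 <= Kg).
Hypothesis f_lip : lip_with
  (prod_dist (prod_dist eucl_dist eucl_dist) eucl_dist) eucl_dist
  (setT `*` A `*` B) Kf f.
Hypothesis g_lip : lip_with eucl_dist abs_dist setT Kg g.
Hypothesis phi_lip : lip_with eucl_dist abs_dist setT Kg phi.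
Local Notation E := 'rV[R]_d.

(** The Gronwall bound for growth rate [kappa] and perturbation rate [r], multiplied by the
    Lipschitz constant of the costs. *)
Definition cost_gap (kappa r : R) : R := Kg * (expR (kappa * T) * (T * r)).

(** Uniformity in [N] comes from [(1 + tau kappa) ^ k <= exp (k tau kappa)] together with
    [k tau <= T]. *)
Lemma running_cost_gap (s t : 'I_N -> E -> E) x (kappa r : R) :
  0 <= kappa -> 0 <= r ->
  (forall i : 'I_N, eucl_dist (s i (traj s x i)) (t i (traj t x i)) <=
     (1 + tau * kappa) * eucl_dist (traj s x i) (traj t x i) + tau * r) ->
  running_cost g phi N (traj s x) <=
  running_cost g phi N (traj t x) + cost_gap kappa r.
Proof.
move=> kappa0 r0 st.
have gap k : (k <= N)%N ->
    eucl_dist (traj s x k) (traj t x k) <= expR (kappa * T) * (T * r).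
  move=> kN; have q1 : 1 <= 1 + tau * kappa by rewrite lerDl mulr_ge0.
  apply: le_trans (traj_gronwall q1 (mulr_ge0 tau0 r0) st kN) _.
  have ktau : k%:R * tau <= T.
    by apply: le_trans NtauT; rewrite ler_wpM2r // ler_nat.
  have q0 : 0 <= 1 + tau * kappa := le_trans ler01 q1.
  apply: ler_pM; [exact: exprn_ge0|exact: mulr_ge0 (mulr_ge0 _ _)| |].
    apply: (@le_trans _ _ (expR (tau * kappa) ^+ k)).
      by rewrite lerXn2r ?nnegrE ?expR_ge0 // expR_ge1Dx.
    by rewrite -expRM_natl ler_expR mulrA [leRHS]mulrC ler_wpM2r.
  by rewrite mulrA ler_wpM2r.
apply: running_cost_leD => [k kN|].
  apply: le_trans (lip_with_le _ (traj t x k) g_lip) _.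
  by rewrite lerD2l ler_wpM2l // gap // ltnW.
apply: le_trans (lip_with_le _ (traj t x N) phi_lip) _.
by rewrite lerD2l ler_wpM2l // gap.
Qed.

Lemma F_dist_le x y a a' b b' : A a -> A a' -> B b -> B b' ->
  eucl_dist (F f tau x a b) (F f tau y a' b') <=
  eucl_dist x y +
    tau * (Kf * (eucl_dist x y + eucl_dist a a' + eucl_dist b b')).
Proof.
move=> Aa Aa' Bb Bb'; rewrite {1}/eucl_dist /F.
have -> : y + tau *: f (y, a', b') - (x + tau *: f (x, a, b)) =
    (y - x) + tau *: (f (y, a', b') - f (x, a, b)).
  by rewrite opprD addrACA -scalerBr.
apply: le_trans (ler_eucl_normD _ _) _; rewrite lerD2l eucl_normZ ger0_norm //.
rewrite ler_wpM2l //; apply: le_trans (f_lip _ _) _ => //.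
rewrite ler_wpM2l //; apply: le_trans (sqrt_sqrD_le _ _) _ => /=.
- exact: sqrtr_ge0.
- exact: eucl_dist_ge0.
- by rewrite lerD2r; apply: sqrt_sqrD_le; exact: eucl_dist_ge0.
Qed.

Lemma Gfb_val (alpha : E * 'rV[R]_nB -> 'rV[R]_nA) z b :
  Gfb A B alpha -> B b -> A (alpha (z, b)).
Proof. by move=> [aA _] Bb; exact: aA. Qed.

Lemma Glip_dist_le L (alpha : E * 'rV[R]_nB -> 'rV[R]_nA) x y b b' :
  0 <= L -> Glip A B L alpha -> B b -> B b' ->
  eucl_dist (alpha (x, b)) (alpha (y, b')) <=
  L * (eucl_dist x y + eucl_dist b b').
Proof.
move=> L0 [_ aL] Bb Bb'.
have /(_ (x, b) (y, b')) aL' := lip_const_le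
  (prod_dist_gt0 (@eucl_dist_gt0 R d) (@eucl_dist_gt0 R nB))
  (fun=> sqrtr_ge0 _) (@eucl_distxx R nA) L0 aL.
apply: le_trans (aL' _ _) _ => //; rewrite ler_wpM2l //.
by apply: sqrt_sqrD_le; exact: eucl_dist_ge0.
Qed.

Lemma Blip_dist_le M (b : E -> 'rV[R]_nB) x y :
  0 <= M -> Blip B M b -> eucl_dist (b x) (b y) <= M * eucl_dist x y.
Proof.
move=> M0 [_ bM].
exact: (lip_const_le (@eucl_dist_gt0 R d)
  (fun=> eucl_dist_ge0 _ _) (@eucl_distxx R nB) M0 bM).
Qed.

(** The controls read off along a closed-loop trajectory, stacked as rows, generate the same
    trajectory in open loop. *)
Lemma fstate_reachable (Omega0 : set E)
    (alpha : 'I_N -> E * 'rV[R]_nB -> 'rV[R]_nA)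
    (b : 'I_N -> E -> 'rV[R]_nB) x k :
  pow (Gfb A B) alpha -> (forall i y, B (b i y)) ->
  Omega0 x -> (k <= N)%N ->
  reachable A B f tau N Omega0 (fstate f tau alpha b x k).
Proof.
move=> aG bB x0 kN; pose z (i : 'I_N) := fstate f tau alpha b x i.
exists x, k, (\matrix_(i < N) alpha i (z i, b i (z i))),
  (\matrix_(i < N) b i (z i)); split => //.
- by move=> i; rewrite rowK; apply: Gfb_val.
- by move=> i; rewrite rowK.
- by apply: eq_traj => i; rewrite !rowK.
Qed.

Lemma Jtilde0_lipschitz L M (alpha : 'I_N -> E * 'rV[R]_nB -> 'rV[R]_nA)
    (b : 'I_N -> E -> 'rV[R]_nB) :
  0 <= L -> 0 <= M -> pow (Glip A B L) alpha -> pow (Blip B M) b ->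
  eucl_lipschitz (fun x => Jtilde0 f g phi tau x alpha b).
Proof.
move=> L0 M0 aL bM; apply: running_cost_lipschitz; first by exists Kg.
  by exists Kg.
move=> i; exists (1 + tau * (Kf * (1 + L * (1 + M) + M))).
  by rewrite ?(addr_ge0, mulr_ge0).
move=> x y _ _; have [[aG _] [[bB _] _]] := (aL i, bM i).
apply: le_trans (F_dist_le _ _ (Gfb_val _ aG (bB x)) (Gfb_val _ aG (bB y))
  (bB x) (bB y)) _.
have xy := eucl_dist_ge0 x y; have bxy := Blip_dist_le x y M0 (bM i).
have := Glip_dist_le x y L0 (aL i) (bB x) (bB y).
set e := eucl_dist x y in xy bxy *; set eb := eucl_dist (b i x) _ in bxy *.
move=> axy; rewrite mulrDl mul1r lerD2l -!mulrA ler_wpM2l // ler_wpM2l //.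
rewrite !mulrDl mul1r lerD //; rewrite lerD2l -mulrA; apply: le_trans axy _.
by rewrite ler_wpM2l // mulrDl mul1r lerD2l.
Qed.

(** The distance between the actions is at most [delta + L (|z - w| + rho)]: first [alpha] is
    replaced by [alpha'] at the reachable state [z], then the Lipschitz bound of [alpha'] is used.
    Since [c] is frozen, no regularity of [b] enters. *)
Lemma strategy_gap L (Omega0 : set E) (delta rho : R)
    (alpha alpha' : 'I_N -> E * 'rV[R]_nB -> 'rV[R]_nA)
    (b : 'I_N -> E -> 'rV[R]_nB) (c : 'I_N -> 'rV[R]_nB) x :
  0 <= L -> 0 <= delta -> 0 <= rho -> Omega0 x ->
  pow (Gfb A B) alpha -> pow (Glip A B L) alpha' ->
  (forall i y, B (b i y)) -> (forall i, B (c i)) ->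
  (forall i : 'I_N,
     eucl_dist (b i (fstate f tau alpha b x i)) (c i) <= rho) ->
  (forall i z y, reachable A B f tau N Omega0 z -> B y ->
     eucl_dist (alpha i (z, y)) (alpha' i (z, y)) <= delta) ->
  Jtilde0 f g phi tau x alpha b <=
  running_cost g phi N (traj (fun i y => F f tau y (alpha' i (y, c i)) (c i)) x)
  + cost_gap (Kf * (1 + L)) (Kf * (delta + (1 + L) * rho)).
Proof.
move=> L0 delta0 rho0 x0 aG aL bB cB bc aa'; apply: running_cost_gap.
- by rewrite ?(addr_ge0, mulr_ge0).
- by rewrite ?(addr_ge0, mulr_ge0).
move=> i; rewrite -/(fstate f tau alpha b x i).
set z := fstate _ _ _ _ _ _; set w := traj _ _ _.
have [aG' _] := aL i.
apply: le_trans (F_dist_le _ _ (Gfb_val _ (aG i) (bB i z))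
  (Gfb_val _ aG' (cB i)) (bB i z) (cB i)) _.
have zR : reachable A B f tau N Omega0 z.
  by apply: fstate_reachable => //; exact: ltnW.
have := aa' i z _ zR (bB i z).
have := Glip_dist_le z w L0 (aL i) (bB i z) (cB i).
have := eucl_dist_triangle (alpha' i (z, b i z)) (alpha i (z, b i z))
  (alpha' i (w, c i)).
have := bc i; rewrite -/z.
have := eucl_dist_ge0 z w.
set e := eucl_dist z w; set eb := eucl_dist (b i z) (c i).
set e1 := eucl_dist (alpha i _) (alpha' i (w, _)).
set e2 := eucl_dist (alpha i _) _; set e3 := eucl_dist (alpha' i _) _.
move=> e_ge0 eb_le e1_le e3_le e2_le.
rewrite mulrDl mul1r -[leRHS]addrA lerD2l -!mulrA -(mulrDr tau) -(mulrDr Kf).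
rewrite ler_wpM2l // ler_wpM2l //.
have : L * eb <= L * rho by rewrite ler_wpM2l.
by lra.
Qed.

(** Here the controls differ by at most [delta + M |z - w|], through the value of [b] at the
    reachable state [z]; the Lipschitz bound of [alpha] then gives the factor [1 + L]. *)
Lemma control_gap L M (Omega0 : set E) (delta : R)
    (alpha : 'I_N -> E * 'rV[R]_nB -> 'rV[R]_nA)
    (b b' : 'I_N -> E -> 'rV[R]_nB) x :
  0 <= L -> 0 <= M -> 0 <= delta -> Omega0 x ->
  pow (Glip A B L) alpha -> pow (Blip B M) b -> pow (Bfb B) b' ->
  (forall i z, reachable A B f tau N Omega0 z ->
     eucl_dist (b' i z) (b i z) <= delta) ->
  Jtilde0 f g phi tau x alpha b' <=
  Jtilde0 f g phi tau x alpha b +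
  cost_gap (Kf * ((1 + L) * (1 + M))) (Kf * ((1 + L) * delta)).
Proof.
move=> L0 M0 delta0 x0 aL bM b'B bb'; apply: running_cost_gap.
- by rewrite ?(addr_ge0, mulr_ge0).
- by rewrite ?(addr_ge0, mulr_ge0).
move=> i; rewrite -/(fstate f tau alpha b' x i) -/(fstate f tau alpha b x i).
set z := fstate _ _ _ _ _ _; set w := fstate _ _ _ _ _ _.
have [[aG _] [[bB _] _]] := (aL i, bM i); have [b'Bi _] := b'B i.
apply: le_trans (F_dist_le _ _ (Gfb_val _ aG (b'Bi z)) (Gfb_val _ aG (bB w))
  (b'Bi z) (bB w)) _.
have zR : reachable A B f tau N Omega0 z.
  apply: fstate_reachable => // [j|j y|]; last exact: ltnW.
    by have [] := aL j.
  by have [b'Bj _] := b'B j.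
have := bb' i z zR.
have := Glip_dist_le z w L0 (aL i) (b'Bi z) (bB w).
have := eucl_dist_triangle (b i z) (b' i z) (b i w).
have := Blip_dist_le z w M0 (bM i).
have := eucl_dist_ge0 z w.
set e := eucl_dist z w; set eb := eucl_dist (b' i z) (b i w).
set e1 := eucl_dist (alpha i _) (alpha i _).
set e2 := eucl_dist (b i z) _; set e3 := eucl_dist (b' i z) _.
move=> e_ge0 e2_le eb_le e1_le e3_le.
rewrite mulrDl mul1r -[leRHS]addrA lerD2l -!mulrA -(mulrDr tau) -(mulrDr Kf).
rewrite ler_wpM2l // ler_wpM2l //.
have : L * eb <= L * (M * e + delta) by rewrite ler_wpM2l //; lra.
by lra.
Qed.

Lemma F_strategy_lipschitz L (alpha : E * 'rV[R]_nB -> 'rV[R]_nA) c :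
  0 <= L -> Glip A B L alpha -> B c ->
  exists2 K, 0 <= K &
    lip_with eucl_dist eucl_dist setT K (fun y => F f tau y (alpha (y, c)) c).
Proof.
move=> L0 aL Bc; exists (1 + tau * (Kf * (1 + L))).
  by rewrite ?(addr_ge0, mulr_ge0).
move=> x y _ _; have [aG _] := aL.
apply: le_trans (F_dist_le _ _ (Gfb_val _ aG Bc) (Gfb_val _ aG Bc) Bc Bc) _.
have := Glip_dist_le x y L0 aL Bc Bc; rewrite eucl_distxx !addr0 => axy.
rewrite mulrDl mul1r lerD2l -!mulrA ler_wpM2l // ler_wpM2l //.
by rewrite mulrDl mul1r lerD2l.
Qed.

Context {dm : measure_display} {Om : measurableType dm}.
Variables (P : probability Om R) (X : Om -> E).
Hypothesis mX : measurable_fun setT (X : Om -> borel E).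
Hypothesis EX : ('E_P[fun w => eucl_norm (X w)] < +oo)%E.
Let Omega0 := law_support P X.
Let OmegaN := reachable A B f tau N Omega0.
Let EJ := @EJtilde0 R d nA nB f g phi tau N dm Om P X.

Lemma expectation_le_support (h h' : E -> R) (c : R) : eucl_lipschitz h' ->
  (forall x, Omega0 x -> h x <= h' x + c) ->
  ('E_P[h \o X] <= 'E_P[h' \o X] + c%:E)%E.
Proof.
move=> h'L hh'; have [mD PD] := law_support_conull P mX.
rewrite -expectationDc; last exact: Lfun1_lipschitz_comp.
apply: expectation_le_as PD _ _ => //; last by move=> w; exact: hh'.
by apply: measurable_funD => //; exact: measurable_lipschitz_comp.
Qed.

(** The net sequence [c] depends on the initial state, but the feedback [b'] built over the net does
    not; as it dominates every such sequence, the pointwise bounds can be integrated. *)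
Lemma expected_strategy_gap L (delta rho : R)
    (alpha alpha' : 'I_N -> E * 'rV[R]_nB -> 'rV[R]_nA)
    (b : 'I_N -> E -> 'rV[R]_nB) :
  compact B -> B !=set0 -> 0 <= L -> 0 <= delta -> 0 < rho ->
  pow (Gfb A B) alpha -> pow (Glip A B L) alpha' -> pow (Bfb B) b ->
  (forall i z, (OmegaN `*` B) z ->
    eucl_dist (alpha i z) (alpha' i z) <= delta) ->
  exists2 b', pow (Bfb B) b' &
    (EJ alpha b <= EJ alpha' b' +
      (cost_gap (Kf * (1 + L)) (Kf * (delta + (1 + L) * rho)))%:E)%E.
Proof.
move=> Bc B0 L0 delta0 rho0 aG aL bB aa'.
have [C [C0 CB Cnet]] := compact_eucl_net Bc B0 rho0.
have gL : eucl_lipschitz g by exists Kg.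
have phiL : eucl_lipschitz phi by exists Kg.
have [|b' [mb' b'C b'L b'max]] := feedback_argmax
    (step := fun i c y => F f tau y (alpha' i (y, c)) c) gL phiL C0.
  by move=> k c cC; exact: F_strategy_lipschitz L0 (aL k) (CB c cC).
exists b'; first by move=> k; split => // x; exact: CB (b'C k x).
rewrite /EJ /EJtilde0; apply: (@expectation_le_support
  (fun x => Jtilde0 f g phi tau x alpha b)
  (fun x => Jtilde0 f g phi tau x alpha' b')) => // x x0.
have bB' i y : B (b i y) by have [] := bB i.
have /choice[c cP] (i : 'I_N) : exists c, c \in C /\
    eucl_dist (b i (fstate f tau alpha b x i)) c <= rho.
  by have [c cC bc] := Cnet _ (bB' i (fstate f tau alpha b x i)); exists c.
apply: le_trans
  (strategy_gap (c := c) L0 delta0 (ltW rho0) x0 aG aL bB' _ _ _) _.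
- by move=> i; apply: CB; case: (cP i).
- by move=> i; case: (cP i).
- by move=> i z y zO By; exact: aa'.
- by rewrite lerD2r; apply: b'max => k; case: (cP k).
Qed.

Lemma expected_control_gap L M (delta : R)
    (alpha : 'I_N -> E * 'rV[R]_nB -> 'rV[R]_nA)
    (b b' : 'I_N -> E -> 'rV[R]_nB) :
  0 <= L -> 0 <= M -> 0 <= delta ->
  pow (Glip A B L) alpha -> pow (Blip B M) b -> pow (Bfb B) b' ->
  (forall i z, OmegaN z -> eucl_dist (b' i z) (b i z) <= delta) ->
  (EJ alpha b' <= EJ alpha b +
    (cost_gap (Kf * ((1 + L) * (1 + M))) (Kf * ((1 + L) * delta)))%:E)%E.
Proof.
move=> L0 M0 delta0 aL bM b'B bb'; apply: (@expectation_le_support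
  (fun x => Jtilde0 f g phi tau x alpha b')
  (fun x => Jtilde0 f g phi tau x alpha b)).
  exact: Jtilde0_lipschitz L0 M0 aL bM.
by move=> x x0; apply: (control_gap (Omega0 := Omega0)).
Qed.

End Comparison.

(** * Near-minimisers of the distance to a family, and the passage to the infimum *)

Lemma dist_Linfty_lt {R : realType} {U : Type} {n : nat} (K : set U)
    (h : U -> 'rV[R]_n) (H : set (U -> 'rV[R]_n)) (D : R) :
  (dist_Linfty K h H < D%:E)%E ->
  exists2 h', H h' & forall z, K z -> eucl_dist (h' z) (h z) <= D.
Proof.
move=> /ereal_inf_lt[_ [h' Hh' <-]] supD; exists h' => // z Kz.
rewrite -lee_fin; apply: le_trans (ltW supD).
by apply: ereal_sup_ubound; exists z.
Qed.

Lemma dist_Linfty_ge0 {R : realType} {U : Type} {n : nat} (K : set U)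
    (h : U -> 'rV[R]_n) (H : set (U -> 'rV[R]_n)) :
  K !=set0 -> (0 <= dist_Linfty K h H)%E.
Proof.
move=> [z Kz]; apply: le_ereal_inf_tmp => _ [h' _ <-].
apply: (@le_trans _ _ (eucl_norm (h z - h' z))%:E).
  by rewrite lee_fin eucl_norm_ge0.
by apply: ereal_sup_ubound; exists z.
Qed.

Lemma dist_Linfty_pow_lt {R : realType} {U : Type} {n N : nat} (K : set U)
    (h : 'I_N -> U -> 'rV[R]_n) (H : set (U -> 'rV[R]_n)) (D : R) :
  (\big[maxe/-oo]_(k < N) dist_Linfty K (h k) H < D%:E)%E ->
  exists2 h', pow H h' &
    forall k z, K z -> eucl_dist (h' k z) (h k z) <= D.
Proof.
move=> /bigmax_ltP[_ hD].
have /choice[h' h'P] (k : 'I_N) : exists h' : U -> 'rV[R]_n,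
    H h' /\ forall z, K z -> eucl_dist (h' z) (h k z) <= D.
  by have [h' Hh' h'D] := dist_Linfty_lt (hD k isT); exists h'.
by exists h' => k; [exact: (h'P k).1|exact: (h'P k).2].
Qed.

(** The distances need not be attained, so estimates are proved for every [D > m]; the choice
    [D = m + r / c] costs only an arbitrary [r > 0]. *)
Lemma le_scaled_of_lt {R : realType} (x m : \bar R) (c e : R) :
  0 < c -> (0 <= m)%E ->
  (forall D : R, 0 < D -> (m < D%:E)%E -> (x <= (c * D + e)%:E)%E) ->
  (x <= c%:E * m + e%:E)%E.
Proof.
move=> c0; case: m => [m| |] // m0 H; last first.
  by rewrite gt0_muley ?lte_fin // addye // leey.
apply/lee_addgt0Pr => r r0; rewrite -EFinM -!EFinD.
have mr : m < m + r / c by rewrite ltrDl divr_gt0.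
have := H (m + r / c); rewrite lte_fin mr => /(_ _ isT).
rewrite mulrDr mulrCA divff ?gt_eqF // mulr1 addrAC; apply.
by apply: le_lt_trans mr; rewrite -lee_fin.
Qed.

Theorem theorem5p3 (R : realType) (d nA nB : nat) (T : R)
    (A : set 'rV[R]_nA) (B : set 'rV[R]_nB)
    (f : 'rV[R]_d * 'rV[R]_nA * 'rV[R]_nB -> 'rV[R]_d)
    (g phi : 'rV[R]_d -> R)
    (hnA : (1 <= nA)%N) (hnB : (1 <= nB)%N) (hT : 0 < T)
    (A_neq0 : A !=set0) (A_compact : compact A)
    (B_neq0 : B !=set0) (B_compact : compact B)
    (f_lip : (lip_const (prod_dist (prod_dist eucl_dist eucl_dist) eucl_dist)
               eucl_dist (setT `*` A `*` B) f < +oo)%E)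
    (g_lip : (lip_const eucl_dist abs_dist setT g < +oo)%E)
    (phi_lip : (lip_const eucl_dist abs_dist setT phi < +oo)%E) :
  exists (CL : R -> R) (CLM : R -> R -> R),
    (forall L, 0 <= L -> 0 < CL L) /\
    (forall L M, 0 <= L -> 0 <= M -> 0 < CLM L M) /\
    forall (N : nat) (L M : R)
      (dm : measure_display) (Om : measurableType dm)
      (P : probability Om R) (X : Om -> 'rV[R]_d)
      (Ghat : set ('rV[R]_d * 'rV[R]_nB -> 'rV[R]_nA))
      (Bhat : set ('rV[R]_d -> 'rV[R]_nB))
      (eta1 eta2 eps1 eps2 : R)
      (alphahat alphastar : 'I_N -> 'rV[R]_d * 'rV[R]_nB -> 'rV[R]_nA)
      (bhat bstar : 'I_N -> 'rV[R]_d -> 'rV[R]_nB),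
    let tau := T / N%:R in
    let Omega0 := law_support P X in
    let OmegaN := reachable A B f tau N Omega0 in
    let EJ := EJtilde0 f g phi tau P X in
    let EVhat := EJ alphahat bhat in
    let EV := EV0 A B f g phi tau N P X in
    (1 <= N)%N -> 0 <= L -> 0 <= M ->
    0 < eta1 -> 0 < eta2 -> 0 < eps1 -> 0 < eps2 ->
    measurable_fun setT (X : Om -> borel 'rV[R]_d) ->
    compact Omega0 ->
    ('E_P[fun w => eucl_norm (X w)] < +oo)%E ->
    Ghat `<=` Gfb A B -> Bhat `<=` Bfb B ->
    algorithm_output f g phi tau P X Ghat Bhat eta1 eta2 alphahat bhat ->
    pow (Ghat `&` Glip A B L) alphahat ->
    pow (Bhat `&` Blip B M) bhat ->
    pow (Glip A B L) alphastar ->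
    pow (Blip B M) bstar ->
    (EV >= ereal_sup [set EJ alphastar b | b in pow (Bfb B)] - eps1%:E)%E ->
    (EV <= EJ alphahat bstar + eps2%:E)%E ->
    (EVhat - EV <=
      (CL L)%:E *
        \big[maxe/-oo]_(k < N)
          dist_Linfty (OmegaN `*` B) (alphastar k) (Ghat `&` Glip A B L) +
      eta1%:E + eps1%:E)%E /\
    (EVhat - EV >=
      - ((CLM L M)%:E *
           \big[maxe/-oo]_(k < N)
             dist_Linfty OmegaN (bstar k) (Bhat `&` Blip B M)) -
      eta2%:E - eps2%:E)%E.
Proof.
have [Kf Kf0 fK] := lip_const_lty
  (prod_dist_gt0 (prod_dist_gt0 (@eucl_dist_gt0 R d) (@eucl_dist_gt0 R nA))
    (@eucl_dist_gt0 R nB)) (fun=> sqrtr_ge0 _) (@eucl_distxx R d) f_lip.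
have abs_distxx (r : R) : abs_dist r r = 0 by rewrite /abs_dist subrr normr0.
have [Kg1 Kg10 gK1] := lip_const_lty (@eucl_dist_gt0 R d)
  (fun=> eucl_dist_ge0 _ _) abs_distxx g_lip.
have [Kg2 Kg20 phiK2] := lip_const_lty (@eucl_dist_gt0 R d)
  (fun=> eucl_dist_ge0 _ _) abs_distxx phi_lip.
pose Kg := Kg1 + Kg2; have Kg0 : 0 <= Kg by exact: addr_ge0.
have gK : lip_with eucl_dist abs_dist setT Kg g.
  move=> x y _ _; apply: le_trans (gK1 x y I I) _.
  by rewrite ler_wpM2r ?eucl_dist_ge0 // lerDl.
have phiK : lip_with eucl_dist abs_dist setT Kg phi.
  move=> x y _ _; apply: le_trans (phiK2 x y I I) _.
  by rewrite ler_wpM2r ?eucl_dist_ge0 // lerDr.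
have T0 : 0 <= T := ltW hT.
(* [Kg + 1] and [Kf + 1] keep the constants positive even when the Lipschitz constants vanish. *)
pose C kappa lam := (Kg + 1) * (expR (kappa * T) * (T * ((Kf + 1) * lam))).
have C_gt0 kappa lam : 0 < lam -> 0 < C kappa lam.
  by move=> lam0; rewrite ?(mulr_gt0, expR_gt0) ?ltr_wpDl.
have gapC kappa lam D r :
    0 <= lam -> 0 <= D -> 0 <= r -> r <= (Kf + 1) * lam * D ->
    cost_gap T Kg kappa r <= C kappa lam * D.
  move=> lam0 D0 r0 rD; rewrite /cost_gap /C -!mulrA.
  apply: ler_pM => //; first by rewrite ?(mulr_ge0, expR_ge0).
    by rewrite lerDl.
  by rewrite ler_wpM2l ?expR_ge0 // ler_wpM2l // mulrA.
exists (fun L => C (Kf * (1 + L)) 1),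
  (fun L M => C (Kf * ((1 + L) * (1 + M))) (1 + L)).
split; first by move=> L L0; exact: C_gt0.
split; first by move=> L M L0 M0; apply: C_gt0; rewrite ltr_pwDl.
move=> N L M dm Om P X Ghat Bhat eta1 eta2 eps1 eps2.
move=> alphahat alphastar bhat bstar.
move=> tau Omega0 OmegaN EJ EVhat EV N1 L0 M0 _ _ _ _ mX _ EX GhatG BhatB.
move=> [_ _ alg1 alg2] ahL bhM asL bsM EV_ge EV_le.
have tau0 : 0 <= tau by rewrite divr_ge0.
have NtauT : N%:R * tau <= T by rewrite mulrC divfK // pnatr_eq0 -lt0n.
have [mD PD] := law_support_conull P mX.
have capL : pow (Glip A B L) alphahat by move=> k; case: (ahL k).
have capM : pow (Blip B M) bhat by move=> k; case: (bhM k).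
have EJ_fin (alpha : 'I_N -> _) b : pow (Glip A B L) alpha ->
    pow (Blip B M) b -> EJ alpha b \is a fin_num.
  move=> aL bM; apply: expectation_fin_num; apply: (Lfun1_lipschitz_comp
    (h := fun x => Jtilde0 f g phi tau x alpha b) mX EX).
  exact: (Jtilde0_lipschitz tau0 Kf0 Kg0 fK gK phiK L0 M0 aL bM).
have Blip_Bfb (b : 'I_N -> 'rV[R]_d -> 'rV[R]_nB) :
    pow (Blip B M) b -> pow (Bfb B) b by move=> bM k; case: (bM k).
(* The two assumptions on [EV] place it between costs of Lipschitz pairs, [(alphastar, bhat)] and
   [(alphahat, bstar)], which are integrable. *)
have EVfin : EV \is a fin_num.
  rewrite fin_numE -ltNye -ltey; apply/andP; split.
    apply: lt_le_trans EV_ge; rewrite lteBrDr //.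
    apply: (@lt_le_trans _ _ (EJ alphastar bhat)).
      by rewrite ltNye; have /fin_numP[] := EJ_fin _ _ asL capM.
    by apply: ereal_sup_ubound; exists bhat => //; exact: Blip_Bfb.
  apply: le_lt_trans EV_le _.
  by rewrite lte_add_pinfty ?ltry // ltey_eq EJ_fin.
(* A point of the support makes the sets under the suprema non-empty, so that the distances are not
   [-oo]. *)
have [x0 Omega0x0] : Omega0 !=set0.
  apply/set0P/eqP => Omega00; have := PD.
  rewrite -/Omega0 Omega00 preimage_set0.
  by rewrite setC0 probability_setT => /eqP; rewrite onee_eq0.
have [a0 Aa0] := A_neq0; have [b0 Bb0] := B_neq0.
have OmegaNx0 : OmegaN x0.
  exists x0, 0%N, (\matrix_(i < N) a0), (\matrix_(i < N) b0).
  by split => // i; rewrite rowK.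
have maxdist_ge0 (U : Type) n (K : set U) (h : 'I_N -> U -> 'rV[R]_n) H :
    K !=set0 -> (0 <= \big[maxe/-oo]_(k < N) dist_Linfty K (h k) H)%E.
  move=> K0; apply: (@le_trans _ _ (dist_Linfty K (h (Ordinal N1)) H)).
    (* [1 <= N] provides an index, so the maximum is not just its default [-oo]. *)
    exact: dist_Linfty_ge0.
  exact: (@le_bigmax _ _ _ _ (fun k => dist_Linfty K (h k) H)).
have [u EVhatE] : exists u, EVhat = u%:E.
  by exists (fine EVhat); rewrite fineK // EJ_fin.
have [v EVE] : exists v, EV = v%:E by exists (fine EV); rewrite fineK.
have BhatBfb (b : 'I_N -> _) : pow Bhat b -> pow (Bfb B) b.
  by move=> bH k; exact: BhatB.
rewrite EVhatE EVE -EFinB; split.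
- rewrite -addeA; apply: le_scaled_of_lt; first exact: C_gt0.
    by apply: maxdist_ge0; exists (x0, b0).
  move=> D D0 /dist_Linfty_pow_lt[alpha aH aD].
  (* With this mesh [Kf (1 + L) rho <= D], so the net error is absorbed in passing from [Kf D] to
     [(Kf + 1) D]. *)
  pose rho := D / ((Kf + 1) * (1 + L)).
  have Kf1 : 0 < Kf + 1 by rewrite ltr_wpDl.
  have L1 : 0 < 1 + L by rewrite ltr_pwDl.
  have rho0 : 0 < rho by rewrite divr_gt0 // mulr_gt0.
  (* The comparison feedback [b'] need only lie in [Bfb], over which the near-optimality of
     [alphastar] holds. *)
  have EJ_le b : pow Bhat b ->
      (EJ alpha b <= (v + eps1 + C (Kf * (1 + L)) 1 * D)%:E)%E.
    move=> bB; have aG : pow (Gfb A B) alpha.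
      by move=> k; case: (aH k) => /GhatG.
    have [b' b'B EJb'] := expected_strategy_gap tau0 NtauT Kf0 Kg0 fK gK phiK
      mX EX B_compact B_neq0 L0 (ltW D0) rho0 aG asL (BhatBfb b bB) aD.
    apply: le_trans EJb' _; rewrite EFinD leeD //.
      rewrite EFinD -leeBlDr // -EVE; apply: le_trans EV_ge.
      by rewrite leeD2r //; apply: ereal_sup_ubound; exists b'.
    rewrite lee_fin; apply: gapC => //; first exact: ltW.
      exact: mulr_ge0 Kf0 (addr_ge0 (ltW D0) (mulr_ge0 (ltW L1) (ltW rho0))).
    have -> : (1 + L) * rho = D / (Kf + 1).
      by rewrite /rho; field; rewrite !gt_eqF.
    rewrite mulr1 mulrDr mulrDl lerD2l mul1r mulrCA ger_pMr //.
    by rewrite ler_pdivrMr // mul1r lerDl.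
  rewrite lee_fin lerBlDr -lee_fin -EVhatE.
  apply: (@le_trans _ _ (ereal_sup [set EJ alphahat b | b in pow Bhat])).
    by apply: ereal_sup_ubound; exists bhat => // k; case: (bhM k).
  apply: le_trans alg1 _.
  apply: (@le_trans _ _ ((v + eps1 + C (Kf * (1 + L)) 1 * D)%:E + eta1%:E)%E).
    rewrite leeD2r //; apply: le_trans (ereal_inf_lbound _) _.
      by exists alpha => // k; case: (aH k).
    by apply: ge_ereal_sup => _ [b bB <-]; exact: EJ_le.
  by rewrite -EFinD lee_fin; lra.
- set m := \big[_/_]_(k < N) _; set c := C _ _.
  have c0 : 0 < c by apply: C_gt0; rewrite ltr_pwDl.
  have m0 : (0 <= m)%E by apply: maxdist_ge0; exists x0.
  (* The lower bound with signs reversed, so that [le_scaled_of_lt] applies. [EV] is bounded by the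
     cost of [(alphahat, bstar)], then of [(alphahat, b)] with [b] near [bstar] in the approximation
     space, then by [EVhat + eta2]. *)
  have : ((v - u)%:E <= c%:E * m + (eta2 + eps2)%:E)%E.
    apply: le_scaled_of_lt => // D D0 /dist_Linfty_pow_lt[b bH bD].
    have bB : pow Bhat b by move=> k; case: (bH k).
    have bM : pow (Blip B M) b by move=> k; case: (bH k).
    have EJb := expected_control_gap tau0 NtauT Kf0 Kg0 fK gK phiK
      mX EX L0 M0 (ltW D0) capL bM (Blip_Bfb bstar bsM).
    have EJb_le : (EJ alphahat b <= (u + eta2)%:E)%E.
      rewrite EFinD -leeBlDr // -EVhatE; apply: le_trans alg2.
      by rewrite leeD2r //; apply: ereal_sup_ubound; exists b.
    have : (v%:E <= (u + eta2 + c * D + eps2)%:E)%E.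
      rewrite -EVE EFinD; apply: le_trans EV_le _; rewrite leeD2r //.
      apply: le_trans (EJb _) _ => [i z zO|]; first by rewrite eucl_distC bD.
      rewrite EFinD leeD // lee_fin.
      apply: gapC; rewrite ?addr_ge0 ?(ltW D0) //.
        by rewrite ?(mulr_ge0, addr_ge0) // ltW.
      by rewrite -mulrA ler_wpM2r ?lerDl // mulr_ge0 ?addr_ge0 // ltW.
    by rewrite !lee_fin; lra.
  case: m m0 => [m| |] // _; last by rewrite gt0_muley ?lte_fin //= leNye.
  by rewrite -EFinM -!EFinB -EFinD !lee_fin; lra.
Qed.
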